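(* Let $G$ be a finite group, let $*$ be a nonidentical involutory antiautomorphism of $G$ with $gg^*\in Z(G)$ for every $g\in G$, and let $g_0\in Z(G)$ with $g_0^*=g_0$. Let $\beta\in\{xy,\,x^*y,\,yx,\,yx^*\}$, $\gamma\in\{xy,\,yx\}$ and $\delta\in\{g_0xy,\,g_0xy^*,\,g_0x^*y,\,g_0x^*y^*,\,g_0yx,\,g_0yx^*,\,g_0y^*x,\,g_0y^*x^*\}$. Then the loop $L=Q(G,*,g_0,\beta,\gamma,\delta)$ is left Bol if and only if at least one of the following holds: (a) $L$ is Moufang; (b) $G/Z(G)$ is an elementary abelian $2$-group and $(\beta,\gamma,\delta)$ is among $(xy,yx,g_0yx)$, $(x^*y,xy,g_0x^*y)$; (c) $G$ is commutative, $(xx)^*=xx$ for every $x\in G$, and $(\beta,\gamma,\delta)$ is among $(xy,xy,g_0x^*y)$, $(x^*y,xy,g_0xy)$; (d) $G/Z(G)$ is an elementary abelian $2$-group, $(xx)^*=xx$ for every $x\in G$, and $(\beta,\gamma,\delta)$ is among $(xy,xy,g_0x^*y)$, $(xy,yx,g_0yx^* )$, $(x^*y,xy,g_0xy)$, $(x^*y,yx,g_0yx)$.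
   Context: $Z(G)$ is the center of $G$. An involutory antiautomorphism $*$ of $G$ satisfies $(g^* )^*=g$ and $(gh)^*=h^*g^*$; nonidentical means $g^*\neq g$ for some $g\in G$. A word such as $yx^*$ or $g_0y^*x$ denotes the function $G\times G\to G$ sending $(x,y)$ to the value of the word. Words are regarded as functions: two words are identified when they define the same function on $G\times G$ (for instance $xy$ and $yx$ when $G$ is commutative), and equality of triples $(\beta,\gamma,\delta)$ means equality of the three functions. Let $Gu=\{gu : g\in G\}$ be a disjoint copy of $G$. The loop $Q(G,*,g_0,\beta,\gamma,\delta)$ is the set $G\cup Gu$ with the multiplication, for $x,y\in G$, $$x\circ y=xy,\quad x\circ yu=\beta(x,y)u,\quad xu\circ y=\gamma(x,y)u,\quad xu\circ yu=\delta(x,y).$$ It is a loop with neutral element $1\in G$. The trivial group counts as an elementary abelian $2$-group. A loop is left Bol if it satisfies $x(y(xz))=(x(yx))z$, and Moufang if it satisfies $x(y(xz))=((xy)x)z$. *)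

(* Defs.v *)
From mathcomp Require Import all_boot all_fingroup all_solvable.
Set Implicit Arguments.
Unset Strict Implicit.
Unset Printing Implicit Defensive.

Section LoopIdentities.
Variables (L : Type) (op : L -> L -> L) (e : L).

Definition is_loop : Prop :=
  [/\ left_id e op, right_id e op,
      forall a b, exists! x, op a x = b
    & forall a b, exists! y, op y a = b].

Definition left_bol_loop : Prop :=
  is_loop /\ forall x y z, op x (op y (op x z)) = op (op x (op y x)) z.

Definition moufang_loop : Prop :=
  is_loop /\ forall x y z, op x (op y (op x z)) = op (op (op x y) x) z.

End LoopIdentities.

(* Words in x and y, regarded as functions on G x G: being finite functions,
   two words are (Leibniz and boolean) equal iff they have the same values. *)
Definition word (G : finGroupType) (f : G -> G -> G) : {ffun G * G -> G} :=
  [ffun p => f p.1 p.2].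

Notation "[ 'word' x , y => E ]" := (word (fun x y => E))
  (at level 0, x name, y name, format "[ 'word'  x ,  y  =>  E ]").

(* The multiplication of Q(G, *, g0, beta, gamma, delta), on the disjoint union
   of G (inl g is g) and Gu (inr g is gu).  The data * and g0 only occur
   through the words beta, gamma and delta. *)
Definition Qmul (G : finGroupType) (beta gamma delta : {ffun G * G -> G})
    (a b : G + G) : G + G :=
  match a, b with
  | inl x, inl y => inl (x * y)%g
  | inl x, inr y => inr (beta (x, y))
  | inr x, inl y => inr (gamma (x, y))
  | inr x, inr y => inl (delta (x, y))
  end.

Definition Qone (G : finGroupType) : G + G := inl 1%g.

(* Main.v *)
Require Import Defs.
From mathcomp Require Import all_boot all_fingroup all_solvable.

(* Up to the central factor g0, every word involved is determined by three
   flags: whether x and y are swapped, and whether each of them is starred.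
   The Bol identity of L splits into eight identities in G according to the
   cosets of its arguments; the one inside G is trivial, and since g0 is central
   and fixed by the involution it cancels from the other seven.  Evaluating
   these at units shows that L is left Bol iff
   - y is not starred in delta (as the involution is nonidentical);
   - G is commutative, or beta is not swapped and gamma, delta are both swapped
     or both unswapped;
   - (xx)^* = xx, if x is starred in exactly one of beta and delta;
   - squares are central, unless "x starred in beta", "x starred in delta" and
     "gamma swapped" all agree; in that exceptional case L is Moufang.
   If G is commutative the swaps are immaterial, so one may assume that beta,
   gamma and delta are unswapped; squares being central, (a), (b) or (d) applies. *)

Set Implicit Arguments.
Unset Strict Implicit.
Unset Printing Implicit Defensive.
Local Open Scope group_scope.

(** * The Bol and flexible laws of L as identities in G *)

Section BolEquations.
Variable G : finGroupType.
Implicit Types (b c d : G -> G -> G) (x y z g : G).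

(** The cosets of x, y, z run in lexicographic order, G before Gu, from (G, G, Gu) to (Gu, Gu, Gu).
    Proofs call these identities [e2] to [e8]. *)
Definition bol_equations b c d : Prop :=
  forall x y z : G,
  [/\ b x (b y (b x z)) = b (x * y * x) z,
      b x (c y (x * z)) = c (b x (c y x)) z,
      x * d y (b x z) = d (b x (c y x)) z
    & [/\ d x (b y (c x z)) = d x (b y x) * z,
          c x (y * d x z) = b (d x (b y x)) z,
          c x (d y (c x z)) = c (c x (d y x)) z
        & d x (c y (d x z)) = d (c x (d y x)) z]].

Definition flexible_equations b c d : Prop :=
  forall x y : G,
  [/\ b x (c y x) = c (b x y) x,
      d x (b y x) = d (c x y) x
    & c x (d y x) = b (d x y) x].

(** This is what lets a central factor be pulled out of nested words and cancelled. *)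
Definition homogeneous g (f : G -> G -> G) : Prop :=
  forall x y, f (g * x) y = g * f x y /\ f x (g * y) = g * f x y.

Lemma word_eqP (f f' : G -> G -> G) : f =2 f' <-> word f = word f'.
Proof.
split=> [eqf | /ffunP eqf x y]; last by have:= eqf (x, y); rewrite !ffunE.
by apply/ffunP=> p; rewrite !ffunE.
Qed.

Variables (g : G) (b c d : G -> G -> G).
Hypotheses (g_central : forall x, x * g = g * x).
Hypotheses (gb : homogeneous g b) (gc : homogeneous g c) (gd : homogeneous g d).

Local Notation Q := (Qmul (word b) (word c) (word (fun x y => g * d x y))).

Lemma Qmul_bolP :
  (forall u v w, Q u (Q v (Q u w)) = Q (Q u (Q v u)) w) <->
  bol_equations b c d.
Proof.
have gE x y : x * (g * y) = g * (x * y) by rewrite !mulgA g_central.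
have [bl br] : (forall x y, b (g * x) y = g * b x y) /\
  (forall x y, b x (g * y) = g * b x y) by split=> x y; have [] := gb x y.
have [cl cr] : (forall x y, c (g * x) y = g * c x y) /\
  (forall x y, c x (g * y) = g * c x y) by split=> x y; have [] := gc x y.
have [dl dr] : (forall x y, d (g * x) y = g * d x y) /\
  (forall x y, d x (g * y) = g * d x y) by split=> x y; have [] := gd x y.
(* Rewriting with [E] brings every [g] to the front of both sides. *)
pose E := (bl, br, cl, cr, dl, dr, gE).
split=> [bolQ x y z | eqs].
  split; last split.
  - by have:= bolQ (inl x) (inl y) (inr z); rewrite /= !ffunE /= mulgA => -[].
  - by have:= bolQ (inl x) (inr y) (inl z); rewrite /= !ffunE /= => -[].
  - have:= bolQ (inl x) (inr y) (inr z); rewrite /= !ffunE /= !E.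
    by move=> -[] /mulgI.
  - have:= bolQ (inr x) (inl y) (inl z); rewrite /= !ffunE /= -mulgA.
    by move=> -[] /mulgI.
  - have:= bolQ (inr x) (inl y) (inr z); rewrite /= !ffunE /= !E.
    by move=> -[] /mulgI.
  - have:= bolQ (inr x) (inr y) (inl z); rewrite /= !ffunE /= !E.
    by move=> -[] /mulgI.
  - have:= bolQ (inr x) (inr y) (inr z); rewrite /= !ffunE /= !E.
    by move=> -[] /mulgI/mulgI.
case=> x [] y [] z; rewrite /= ?ffunE /= ?E; congr (_ _);
  have [e2 e3 e4 [e5 e6 e7 e8]] := eqs x y z => //.
- by rewrite !mulgA.
- by rewrite e2 mulgA.
- by rewrite e4.
- by rewrite e5 mulgA.
- by rewrite e6.
- by rewrite e7.
- by rewrite e8.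
Qed.

Lemma Qmul_flexible : flexible_equations b c d ->
  forall u v, Q u (Q v u) = Q (Q u v) u.
Proof.
move=> flex [] x [] y; rewrite /= ?ffunE /= ?mulgA //; congr (_ _);
  have [f1 f2 f3] := flex x y => //; first by rewrite f2.
by have [[_ ->] [-> _]] := (gc x (d y x), gb (d x y) x); rewrite f3.
Qed.

End BolEquations.

(** * Left Bol, flexible and Moufang loops *)

Section LoopBasics.
Variables (L : Type) (op : L -> L -> L) (e : L).

(** The Moufang identity at z = e is the flexible law, which turns (xy)x into x(yx). *)
Lemma moufang_left_bol : moufang_loop op e -> left_bol_loop op e.
Proof.
case=> loop mou; split=> // x y z; rewrite mou; congr (op _ z).
by case: loop => _ op1 _ _; have:= mou x y e; rewrite !op1.
Qed.

Lemma left_bol_flexible_moufang :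
  left_bol_loop op e -> (forall x y, op x (op y x) = op (op x y) x) ->
  moufang_loop op e.
Proof. by case=> loop bol flex; split=> // x y z; rewrite bol flex. Qed.

End LoopBasics.

(** * Words over an involution with central norms [x * star x] *)

Section StarWords.
Variables (G : finGroupType) (star : G -> G).
Hypotheses (starK : involutive star)
  (starM : forall x y, star (x * y) = star y * star x)
  (norm_central : forall x y, y * (x * star x) = x * star x * y).

Definition starword (s a b : bool) (x y : G) : G :=
  let x' := if a then star x else x in
  let y' := if b then star y else y in
  if s then y' * x' else x' * y'.

Lemma star1 : star 1 = 1.
Proof. by apply: (mulgI (star 1)); rewrite -starM !mulg1. Qed.

(** The norm of x commutes with x itself; cancel x on the left. *)
Lemma star_mulC x : star x * x = x * star x.
Proof. by apply: (mulgI x); rewrite mulgA norm_central. Qed.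

Lemma starword_homogeneous g s a b :
  (forall x, x * g = g * x) -> star g = g -> homogeneous g (starword s a b).
Proof.
move=> gC g_star x y; rewrite /starword.
have gE u v : u * (g * v) = g * (u * v) by rewrite !mulgA gC.
by case: s a b => [] [] []; split;
  rewrite ?starM ?g_star ?gC -?mulgA ?gC -?mulgA
  ?gE ?gC ?mulgA ?gC ?mulgA.
Qed.

(** By finiteness, divisibility in L reduces to injectivity of the translations. *)
Lemma exists_unique_preimage (T : finType) (f : T -> T) :
  injective f -> forall u, exists! v, f v = u.
Proof.
move=> f_inj u; have [f' fK f'K] := injF_bij f_inj.
by exists (f' u); split=> // v <-.
Qed.

Lemma starword_loop g s1 a1 s2 s3 a3 b3 :
  is_loop (Qmul (word (starword s1 a1 false)) (word (starword s2 false false))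
                (word (fun x y => g * starword s3 a3 b3 x y))) (Qone G).
Proof.
split.
- by case=> x; rewrite /= ?ffunE ?mul1g //= /starword star1;
    case: s1 a1 => [] []; rewrite ?mul1g ?mulg1.
- by case=> x; rewrite /= ?ffunE ?mulg1 //= /starword;
    case: s2; rewrite ?mul1g ?mulg1.
- move=> u; apply: exists_unique_preimage => -[] y [] z; case: u => x //=;
    rewrite ?ffunE /= /starword => -[].
  + by move/mulgI->.
  + by case: s2 => [/mulIg|/mulgI] ->.
  + by case: s1 a1 => [] [] => [/mulIg|/mulIg|/mulgI|/mulgI] ->.
  + by move/mulgI; case: s3 b3 => [] [] => [/mulIg|/mulIg|/mulgI|/mulgI];
      try (move/(can_inj starK)); move->.
- move=> u b; apply: (@exists_unique_preimage _ (fun y => Qmul _ _ _ y u)).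
  move=> -[] y [] z; case: u => x //=; rewrite ?ffunE /= /starword => -[].
  + by move/mulIg->.
  + by case: s1 a1 => [] [] => [/mulgI|/mulgI|/mulIg|/mulIg];
      try (move/(can_inj starK)); move->.
  + by case: s2 => [/mulgI|/mulIg] ->.
  + by move/mulgI; case: s3 a3 => [] [] => [/mulgI|/mulgI|/mulIg|/mulIg];
      try (move/(can_inj starK)); move->.
Qed.

Lemma starword_bol (s a d : bool) :
  (a != d -> forall x : G, star (x * x) = x * x) ->
  ((a == s) && (s == d) \/ forall x y : G, x * x * y = y * (x * x)) ->
  bol_equations (starword false a false) (starword s false false)
     (starword s d false).
Proof.
move=> S C x y z.
(* These rules collect norms, in either order of their factors, at the front; they suffice when the
   three flags agree. *)
have normE t : (t * x * star x = x * star x * t)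
    * (t * star x * x = x * star x * t) * (star x * x = x * star x).
  by rewrite -!(mulgA t) star_mulC norm_central.
have [/andP[/eqP-> /eqP->] | neq] := boolP ((a == s) && (s == d)).
  by case: d {S C} => /=; split; last split;
    rewrite /starword ?starM ?starK ?mulgA ?normE ?mulgA.
have {neq} C (u v : G) : u * u * v = v * (u * u) by case: C neq => [-> // | ->].
have sqE t : t * x * x = x * x * t by rewrite C mulgA.
(* After multiplication by x on the right, the left side contains the central square of x and the
   right side its central norm; both become [x * x * star x * t]. *)
have symE t : star x * t * x = x * t * star x.
  apply: (mulIg x); rewrite sqE -[in RHS]mulgA star_mulC norm_central -!mulgA.
  by congr (x * _); rewrite !mulgA star_mulC.
have [<- {S} | /S {}S] := eqVneq a d.
  by case: s a => [] []; split; last split;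
    rewrite /starword ?starM ?starK ?mulgA ?normE ?sqE ?symE ?mulgA.
(* When a and d differ, x and [star x] have the same central square, so two stars may be dropped
   together. *)
have SE t : (t * star x * star x = x * x * t) * (star x * star x = x * x)
    * (star x * t * star x = x * t * x).
  have S' : star x * star x = x * x by rewrite -starM S.
  split; first by rewrite -mulgA S' C.
  apply: (mulIg x); rewrite sqE -[LHS]mulgA star_mulC norm_central.
  by rewrite -!mulgA; congr (x * _); rewrite !mulgA S'.
by case: s a d => [] [] []; split; last split;
  rewrite /starword ?starM ?starK ?mulgA ?normE ?sqE ?symE ?SE ?mulgA.
Qed.

Lemma starword_bol_inv (sb a s sd d b : bool) :
  (exists x, star x <> x) ->
  bol_equations (starword sb a false) (starword s false false)
     (starword sd d b) ->
  [/\ b = false,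
      (forall x y : G, x * y = y * x) \/ sb = false /\ s = sd,
      a != d -> forall x : G, star (x * x) = x * x
    & (forall x y : G, x * x * y = y * (x * x)) \/ (a == s) && (s == d)].
Proof.
move=> star_nonid bol.
have b0 : b = false.
  case: b star_nonid bol => // -[z star_z] bol; case: star_z.
  (* If delta stars y, this identity reads [star z = z]. *)
  have [_ _ _ [+ _ _ _]] := bol 1 1 z.
  by rewrite /starword; case: sb a s sd d {bol} => [] [] [] [] [];
    rewrite ?star1 ?mul1g ?mulg1 ?star1 ?mul1g ?mulg1.
rewrite {b}b0 in bol *.
have ab : (forall x y : G, x * y = y * x) \/ sb = false /\ s = sd.
  case: sb bol => bol.
    (* With x' standing for x or [star x], the identity says that x z x' is x x' z or z x x'.
       Cancellation, helped by central norms, gives commutativity. *)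
    left=> x z; have [_ + _ _] := bol x 1 z.
    rewrite /starword; case: a s {bol} => [] [];
      rewrite ?mul1g ?mulg1 ?mulgA => e3.
    + by apply/esym/(mulIg (star x)).
    + apply/esym/(mulIg (star x)).
      by rewrite -[LHS]mulgA norm_central.
    + by apply: (mulIg x).
    + by apply/(mulgI x); rewrite !mulgA.
  have [-> | s_sd] := eqVneq s sd; [by right | left=> x z].
  have [_ _ _ [+ _ _ _]] := bol x 1 z.
  rewrite /starword; case: a s sd d {bol} s_sd => [] [] [] [] // _;
    rewrite ?star1 ?mul1g ?mulg1 ?mulgA => e5.
  + by apply/esym/(mulgI (star x)); rewrite !mulgA.
  + by apply/esym/(mulgI x); rewrite !mulgA.
  + by apply: (mulIg (star x)); rewrite e5 -norm_central mulgA.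
  + by apply/esym/(mulgI x); rewrite !mulgA.
  + by apply/esym/(mulgI (star x)); rewrite !mulgA.
  + by apply/esym/(mulgI x); rewrite !mulgA.
  + by apply: (mulIg (star x)); rewrite e5 -norm_central mulgA.
  + by apply/esym/(mulgI x); rewrite !mulgA.
have S : a != d -> forall x : G, star (x * x) = x * x.
  (* If x is starred only in delta, [e4] is the claim; if only in beta, [e6] is. *)
  move=> a_d x; have [_ _ e4 [_ e6 _ _]] := bol x 1 1.
  move: e4 e6; rewrite /starword; case: a d {bol} a_d => [] [] // _;
    case: sb s sd {ab} => [] [] [];
    rewrite ?star1 ?mul1g ?mulg1 ?star1 ?mul1g ?mulg1 //.
split=> //.
case: ab => [ab | [sb0 s_sd]]; first by left=> x y; rewrite ab.
(* A converse to [symE] in [starword_bol]: multiply by [star x] on the left and use central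
   norms. *)
have symC : (forall x y, x * y * star x = star x * y * x) ->
    forall x y : G, x * x * y = y * (x * x).
  move=> sym x y; apply: (mulgI (star x)); rewrite !mulgA.
  rewrite star_mulC -[in RHS]sym -[RHS]mulgA star_mulC norm_central.
  by rewrite -!mulgA; congr (x * _); rewrite !mulgA star_mulC.
have [all_eq | neq] := boolP ((a == s) && (s == d)); [by right | left].
(* Six flag patterns remain. In the three swapped ones an identity at y = 1 is centrality of
   squares; in the three unswapped ones an identity at z = 1 is the premise of [symC]. *)
case: sb s sd a d {S} sb0 s_sd neq bol => [] [] [] [] [] //= _ _ _ bol.
- move=> x y; have [_ _ _ [+ _ _ _]] := bol x 1 y.
  by rewrite /starword star1 !mul1g mulgA.
- move=> x y; have [_ + _ _] := bol x 1 y.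
  by rewrite /starword !mulg1 !mulgA.
- move=> x y; have [_ + _ _] := bol x 1 y.
  by rewrite /starword !mulg1 !mulgA.
(* Here delta stars its first argument, so [star y] is substituted to recover y. *)
- apply: symC => x y; have [_ _ + _] := bol x (star y) 1.
  by rewrite /starword !starM !starK !mulg1 !mulgA.
- apply: symC => x y; have [_ _ + _] := bol x y 1.
  by rewrite /starword !mulg1 !mulgA.
- apply: symC => x y; have [_ _ _ [_ + _ _]] := bol x y 1.
  by rewrite /starword !mulg1 !mulgA.
Qed.

(** * The loops with the central factor restored *)

Variables (g : G).
Hypotheses (g_central : forall x, x * g = g * x) (g_star : star g = g).

(** Products are associated as in [g0 * x * y], so that the words allowed for delta are instances by
    conversion. *)
Definition scaled_starword (s a b : bool) (x y : G) : G :=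
  let x' := if a then star x else x in
  let y' := if b then star y else y in
  if s then g * y' * x' else g * x' * y'.

Lemma scaled_starwordE s a b :
  word (scaled_starword s a b) = word (fun x y => g * starword s a b x y).
Proof.
by apply/word_eqP=> x y; rewrite /scaled_starword /starword; case: s;
  rewrite mulgA.
Qed.

Local Notation Q sb a s sd d b :=
  (Qmul (word (starword sb a false)) (word (starword s false false))
        (word (scaled_starword sd d b))).

Lemma left_bol_starwordE sb a s sd d b :
  left_bol_loop (Q sb a s sd d b) (Qone G) <->
  bol_equations (starword sb a false) (starword s false false)
                (starword sd d b).
Proof.
have homo := starword_homogeneous _ _ _ g_central g_star.
rewrite /left_bol_loop scaled_starwordE.
have bolP := Qmul_bolP g_central (homo sb a false) (homo s false false)
  (homo sd d b).
split=> [[_] /bolP // | /bolP bol].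
by split=> //; apply: starword_loop.
Qed.

(** For s = [false] all words are unswapped and unstarred, and flexibility is associativity. For s =
    [true] it reduces to centrality of norms. *)
Lemma starword_moufang s :
  moufang_loop (Q false s s s s false) (Qone G).
Proof.
apply: left_bol_flexible_moufang.
  by apply/left_bol_starwordE/starword_bol; rewrite eqxx //; left.
have homo := starword_homogeneous _ _ _ g_central g_star.
rewrite scaled_starwordE; apply: (Qmul_flexible (homo _ _ _) (homo _ _ _)).
move=> x y; case: s; rewrite /starword ?starM ?starK ?mulgA; split=> //.
  by rewrite star_mulC.
by rewrite -[LHS]mulgA norm_central.
Qed.

End StarWords.

(** Exponent dividing 2 already forces a group to be elementary abelian, so only the squares need to
    lie in the center. *)
Lemma center_quotient_abelem2P (G : finGroupType) :
  2.-abelem ([set: G] / 'Z([set: G])) <->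
  forall x y : G, x * x * y = y * (x * x).
Proof.
have normZ (x : G) : x \in 'N('Z([set: G])).
  by rewrite (subsetP (normal_norm (center_normal _))) ?inE.
split=> [/abelemP[] // _ sq1 x y | sqC].
  have: x ^+ 2 \in 'Z([set: G]).
    by apply: coset_idr => //; rewrite morphX // sq1 ?mem_quotient ?inE.
  by rewrite expgS expg1 => /centerP[_ /(_ y)->]; rewrite ?inE.
apply: exponent2_abelem; apply/exponentP=> _ /morphimP[x Nx _ ->].
rewrite -morphX //= coset_id // expgS expg1.
by apply/centerP; rewrite inE; split=> // y _; apply: sqC.
Qed.

(** * The classification *)

Theorem theorem8p5 (G : finGroupType) (star : G -> G) (g0 : G)
    (beta gamma delta : {ffun G * G -> G})
    (star_inv : forall g, star (star g) = g)
    (star_anti : forall g h, star (g * h) = star h * star g)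
    (star_nonid : exists g, star g <> g)
    (star_central : forall g, g * star g \in 'Z([set: G]))
    (g0_central : g0 \in 'Z([set: G]))
    (g0_star : star g0 = g0)
    (beta_word : beta \in
       [:: [word x, y => x * y]; [word x, y => star x * y];
           [word x, y => y * x]; [word x, y => y * star x]])
    (gamma_word : gamma \in [:: [word x, y => x * y]; [word x, y => y * x]])
    (delta_word : delta \in
       [:: [word x, y => g0 * x * y]; [word x, y => g0 * x * star y];
           [word x, y => g0 * star x * y]; [word x, y => g0 * star x * star y];
           [word x, y => g0 * y * x]; [word x, y => g0 * y * star x];
           [word x, y => g0 * star y * x];
           [word x, y => g0 * star y * star x]]) :
  left_bol_loop (Qmul beta gamma delta) (Qone G) <->
  [\/
      moufang_loop (Qmul beta gamma delta) (Qone G),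
      2.-abelem ([set: G] / 'Z([set: G])) /\
      (beta, gamma, delta) \in
        [:: ([word x, y => x * y], [word x, y => y * x],
             [word x, y => g0 * y * x]);
            ([word x, y => star x * y], [word x, y => x * y],
             [word x, y => g0 * star x * y])],
      [/\ abelian [set: G],
          (forall x : G, star (x * x) = x * x)
        & (beta, gamma, delta) \in
            [:: ([word x, y => x * y], [word x, y => x * y],
                 [word x, y => g0 * star x * y]);
                ([word x, y => star x * y], [word x, y => x * y],
                 [word x, y => g0 * x * y])]]
    |
      [/\ 2.-abelem ([set: G] / 'Z([set: G])),
          (forall x : G, star (x * x) = x * x)
        & (beta, gamma, delta) \in
            [:: ([word x, y => x * y], [word x, y => x * y],
                 [word x, y => g0 * star x * y]);
                ([word x, y => x * y], [word x, y => y * x],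
                 [word x, y => g0 * y * star x]);
                ([word x, y => star x * y], [word x, y => x * y],
                 [word x, y => g0 * x * y]);
                ([word x, y => star x * y], [word x, y => y * x],
                 [word x, y => g0 * y * x])]]].
Proof.
have central g : g \in 'Z([set: G]) -> forall x : G, x * g = g * x.
  by case/centerP=> _ gC x; rewrite gC ?inE.
have normC x y : y * (x * star x) = x * star x * y by exact: central.
have g0C := central g0 g0_central.
have bolP := left_bol_starwordE star_inv star_anti g0C g0_star.
split; last first.
  (* All triples in (b), (c) and (d) have beta unswapped and gamma, delta swapped alike, and squares
     are central in each case. *)
  have star_bol s a d (S : a != d -> forall x : G, star (x * x) = x * x)
      (C : forall x y : G, x * x * y = y * (x * x)) :=
    (bolP false a s s d false).2
      (starword_bol star_inv star_anti normC S (or_intror C)).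
  case=> [mou | [/center_quotient_abelem2P C] | [ab S] |
          [/center_quotient_abelem2P C S]].
  - exact: moufang_left_bol mou.
  - rewrite !inE => /orP[] /eqP[-> -> ->].
      exact: (star_bol true false false).
    exact: (star_bol false true true).
  - have C (x y : G) : x * x * y = y * (x * x).
      by rewrite (centsP ab (x * x) _ y) ?inE.
    rewrite !inE => /orP[] /eqP[-> -> ->].
      exact: (star_bol false false true).
    exact: (star_bol false true false).
  - rewrite !inE => /or4P[] /eqP[-> -> ->].
    + exact: (star_bol false false true).
    + exact: (star_bol true false true).
    + exact: (star_bol false true false).
    + exact: (star_bol true true false).
have [sb [a ->]] : exists sb a, beta = word (starword star sb a false).
  move: beta_word; rewrite !inE => /or4P[] /eqP->.
  - by exists false, false.
  - by exists false, true.
  - by exists true, false.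
  - by exists true, true.
have [s ->] : exists s, gamma = word (starword star s false false).
  move: gamma_word; rewrite !inE => /orP[] /eqP->; first by exists false.
  by exists true.
have [sd [d [b ->]]] :
    exists sd d b, delta = word (scaled_starword star g0 sd d b).
  move: delta_word; rewrite !inE => /or4P[/eqP-> | /eqP-> | /eqP-> | ].
  - by exists false, false, false.
  - by exists false, false, true.
  - by exists false, true, false.
  case/orP=> [/eqP-> | ]; first by exists false, true, true.
  case/or4P=> /eqP->.
  - by exists true, false, false.
  - by exists true, true, false.
  - by exists true, false, true.
  - by exists true, true, true.
move=> /bolP/(starword_bol_inv star_inv star_anti normC star_nonid)[-> ab S C].
(* t is a common swap flag for gamma and delta: [false] if G is commutative, and s otherwise. *)
have {ab C} [t [-> -> -> C]] : exists t,
  [/\ word (starword star sb a false) = word (starword star false a false),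
      word (starword star s false false) = word (starword star t false false),
      word (scaled_starword star g0 sd d false)
        = word (scaled_starword star g0 t d false)
    & (forall x y : G, x * x * y = y * (x * x)) \/ (a == t) && (t == d)].
  case: ab => [ab | [-> <-]]; last by exists s.
  have swap s1 s2 a' b' : starword star s1 a' b' =2 starword star s2 a' b'.
    by move=> x y; rewrite /starword; case: s1 s2 => [] [].
  exists false; rewrite !scaled_starwordE; split.
  - exact/word_eqP/swap.
  - exact/word_eqP/swap.
  - by apply/word_eqP=> x y; rewrite (swap _ false).
  - by left=> x y; rewrite ab.
have [/andP[/eqP-> /eqP->] | neq] := boolP ((a == t) && (t == d)).
  by apply: Or41; apply: starword_moufang.
have C2 : 2.-abelem ([set: G] / 'Z([set: G])).
  by apply/center_quotient_abelem2P; case: C neq => [|->].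
(* Patterns with a = d fall under (b), those with a and d different under (d). *)
case: t a d S neq {C} => [] [] [] //= S _.
- apply: Or44; split; [done | exact: S |].
  by rewrite !inE; apply/or4P/Or44/eqP.
- apply: Or44; split; [done | exact: S |].
  by rewrite !inE; apply/or4P/Or42/eqP.
- apply: Or42; split=> //.
  by rewrite !inE; apply/orP; left; apply/eqP.
- apply: Or42; split=> //.
  by rewrite !inE; apply/orP; right; apply/eqP.
- apply: Or44; split; [done | exact: S |].
  by rewrite !inE; apply/or4P/Or43/eqP.
- apply: Or44; split; [done | exact: S |].
  by rewrite !inE; apply/or4P/Or41/eqP.
Qed.
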